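(* Let $\mathcal{L}$ be a finite lattice with bottom $\hat 0$. For any $\mathcal{X}\subseteq\mathcal{L}_{>\hat 0}$, the set of $\mathcal{L}$-building sets containing $\mathcal{X}$ admits a unique inclusion-minimal element $\tilde{\mathcal{X}}$ (called the $\mathcal{L}$-building closure of $\mathcal{X}$). Moreover, $\tilde{\mathcal{X}}\setminus\mathcal{X}$ is contained in the set of elements $Y\in\mathcal{L}$ such that $\mathcal{L}_{\le Y}\not\cong\prod_{X\in\max(\mathcal{X}_{\le Y})}\mathcal{L}_{\le X}$.
   Context: Notation: $\mathcal{X}_{\le Y}=\{X\in\mathcal{X}:X\le Y\}$, $\mathcal{L}_{\le Y}=\{Z\in\mathcal{L}:Z\le Y\}$, and $\max(\cdot)$ denotes the set of maximal elements. An $\mathcal{L}$-building set is a subset $\mathcal{B}\subseteq\mathcal{L}_{>\hat 0}$ such that for every $Y\in\mathcal{L}_{>\hat 0}$, with $\{B_1,\dots,B_k\}=\max(\mathcal{B}_{\le Y})$, there is a poset isomorphism $\prod_{j=1}^k\mathcal{L}_{\le B_j}\to\mathcal{L}_{\le Y}$ whose $j$-th component is the inclusion of intervals $\mathcal{L}_{\le B_j}\subseteq\mathcal{L}_{\le Y}$. In the claim, $\cong$ is meant in this same sense, i.e. an isomorphism from the product whose components are the inclusions of intervals (the empty product being a one-element poset). *)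

(* Defs.v *)
From mathcomp Require Import all_boot all_order.

Set Implicit Arguments.
Unset Strict Implicit.
Unset Printing Implicit Defensive.

Import Order.TTheory.
Local Open Scope order_scope.

Section BuildingSets.
Context {d : Order.disp_t} {L : finTBLatticeType d}.
Implicit Types (X Y : L) (A B C : {set L}).

(* The interval L_{<= Y}. *)
Definition lower Y : Type := {Z : L | Z <= Y}.

Definition lower_bot Y : lower Y := exist _ \bot (le0x Y).

(* The subset A_{<= Y}. *)
Definition below A Y : {set L} := [set X in A | X <= Y].

Definition maximals A : {set L} :=
  [set X in A | [forall Z in A, (X <= Z) ==> (Z == X)]].

(* The product of the L_{<= X} for X in A; for A = set0 it has exactly one
   element. *)
Definition lower_prod A := {dffun forall X : {X : L | X \in A}, lower (val X)}.

Definition lower_prod_le A (f g : lower_prod A) : Prop :=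
  forall X : {X : L | X \in A}, val (f X) <= val (g X).

Definition lower_inj A (X : {X : L | X \in A}) (Z : lower (val X)) :
    lower_prod A :=
  finfun (dfwith (fun W : {X : L | X \in A} => lower_bot (val W)) Z).

(* "The X-th component of phi is the inclusion" is read as: phi composed with
   the embedding lower_inj of the X-th factor (the other coordinates being the
   bottom element) is the inclusion of L_{<= X} in L_{<= Y}. *)
Definition lower_prod_iso A Y : Prop :=
  exists phi : lower_prod A -> lower Y,
    [/\ bijective phi,
        forall f g, val (phi f) <= val (phi g) <-> lower_prod_le f g
      & forall (X : {X : L | X \in A}) (Z : lower (val X)),
          val (phi (lower_inj Z)) = val Z].

Definition building_set B : Prop :=
  B \subset [set Y : L | \bot < Y] /\
  forall Y, \bot < Y -> lower_prod_iso (maximals (below B Y)) Y.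

Definition minimal_building_set_above A B : Prop :=
  [/\ building_set B, A \subset B
    & forall C, building_set C -> A \subset C -> C \subset B -> C = B].

End BuildingSets.

(* Main.v *)
Require Import Defs.
From mathcomp Require Import all_boot all_order.
Import Order.TTheory.
Local Open Scope order_scope.

(** Building sets containing [A] are closed under intersection, because being
    a building set can be tested at the elements outside the set: [B] is a
    building set as soon as every nonzero [W] outside [B] is a product of
    strictly smaller intervals such that every element of [B] below [W] lies
    in one of these intervals ([building_set_by_splitting]). Indeed, by
    induction the maximal elements of [B] below each factor decompose that
    factor, and decompositions compose ([splits_glue]).

    For an intersection of building sets and [W] outside it, some member [B]
    of the family misses [W], and the decomposition of [W] that [B] provides
    is fine enough for the whole intersection. So the intersection of all
    building sets containing [A] is the least one, a fortiori the unique
    minimal one.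

    For the second claim, suppose that [M], the set of maximal elements of
    [A] below [Y], already decomposes [Y], where [Y] is in the closure [B] but
    not in [A]. Delete from [B] the elements below [Y] that lie below no
    element of [M]. What remains still contains [A], and it has lost [Y]. It
    is again a building set ([building_set_prune]): a deleted [W] decomposes
    into the meets of [W] with the elements of [M] ([splits_restrict]). This
    contradicts minimality.

    All of this takes place inside [L]: an isomorphism from a product whose
    components are the inclusions can only be the join map, so its existence
    is a lattice condition on [D] and [Y] ([lower_prod_isoP]). *)

(** * Product decompositions as a lattice condition *)

(** The join map from the product of the intervals below the elements of [D]
    to the interval below [Y] is well defined, an order embedding and
    surjective, respectively: the second clause recovers a coordinate [U] from
    the join even when all other coordinates are as large as possible, and by
    the third one each [Z] is the join of its coordinates [Z `&` X]. The
    element [\bot] is allowed in [D], so that the meets of the factors with a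
    smaller element can be used without discarding the zero ones. *)
Definition splits {d : Order.disp_t} {L : finTBLatticeType d}
    (D : {set L}) (Y : L) : bool :=
  [&& [forall X in D, X <= Y],
      [forall X in D, forall U : L, (U <= X) ==>
         (X `&` (U `|` \join_(W in D :\ X) W) <= U)]
    & [forall Z : L, (Z <= Y) ==> (Z <= \join_(X in D) (Z `&` X))]].

Lemma splitsP {d : Order.disp_t} {L : finTBLatticeType d}
    {D : {set L}} {Y : L} :
  reflect [/\ forall X, X \in D -> X <= Y,
              forall X U : L, X \in D -> U <= X ->
                X `&` (U `|` \join_(W in D :\ X) W) <= U
            & forall Z : L, Z <= Y -> Z <= \join_(X in D) (Z `&` X)]
          (splits D Y).
Proof.
apply: (iffP and3P) => [[h1 h2 h3]|[h1 h2 h3]]; split.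
- by move=> X XD; move/forall_inP: h1; apply.
- by move=> X U XD UX; move/forall_inP/(_ X XD)/forallP/(_ U)/implyP: h2; apply.
- by move=> Z; move/forallP/(_ Z)/implyP: h3.
- exact/forall_inP.
- by apply/forall_inP => X XD; apply/forallP => U; apply/implyP; apply: h2.
- by apply/forallP => Z; apply/implyP; apply: h3.
Qed.

(** This adjunction makes an isomorphism readable on coordinates: it turns the
    order of [L] between [Z] and the image of [f] into a comparison of [Z] with
    a single coordinate of [f]. *)
Lemma lower_inj_le {d : Order.disp_t} {L : finTBLatticeType d} {D : {set L}}
    (X : {X : L | X \in D}) (Z : lower (val X)) (f : lower_prod D) :
  lower_prod_le (lower_inj Z) f <-> val Z <= val (f X).
Proof.
split=> [/(_ X)|ZfX W]; first by rewrite ffunE dfwith_in.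
rewrite ffunE; have [<-|neq] := eqVneq X W; first by rewrite dfwith_in.
by rewrite dfwith_out // le0x.
Qed.

Lemma splits_of_iso {d : Order.disp_t} {L : finTBLatticeType d}
    (D : {set L}) (Y : L) :
  lower_prod_iso D Y -> splits D Y.
Proof.
case=> phi [[psi phiK psiK] phi_le phi_inj].
have le_phi (X : {X : L | X \in D}) (Z : L) f :
    Z <= val X -> (Z <= val (phi f)) <-> (Z <= val (f X)).
  move=> ZX; pose z : lower (val X) := exist _ Z ZX.
  rewrite -{1}[Z]/(val z) -(phi_inj X z).
  exact: iff_trans (phi_le _ _) (lower_inj_le X z f).
apply/splitsP; split.
- move=> X XD; pose x : {X : L | X \in D} := exist _ X XD.
  have := valP (phi (lower_inj (X := x) (exist _ X (lexx X)))).
  by rewrite phi_inj.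
- move=> X U XD UX.
  pose x : {X : L | X \in D} := exist _ X XD.
  (* The worst case: [U] in coordinate [X] and the top everywhere else. *)
  pose f : lower_prod D := finfun (dfwith
    (fun W : {X : L | X \in D} => exist _ (val W) (lexx _) : lower (val W))
    (exist _ U UX : lower (val x))).
  have fx : val (f x) = U by rewrite ffunE dfwith_in.
  have ZX : X `&` (U `|` \join_(W in D :\ X) W) <= X by exact: leIl.
  rewrite -[leRHS]fx; apply/(le_phi x) => //.
  apply: le_trans (leIr _ _) _; rewrite leUx; apply/andP; split.
    by apply/(le_phi x) => //; rewrite fx.
  apply/joinsP => W; rewrite !inE => /andP[WX WD].
  apply/(le_phi (exist _ W WD)) => //=.
  by rewrite ffunE dfwith_out // -val_eqE eq_sym.
- move=> Z ZY; set J := \join_(X in D) _.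
  have JY : J <= Y.
    by apply/joinsP => X _; apply: le_trans ZY; exact: leIl.
  pose z : lower Y := exist _ Z ZY; pose j : lower Y := exist _ J JY.
  rewrite -[Z]/(val z) -[J]/(val j) -[z]psiK -[j]psiK; apply/phi_le => X.
  have psiX (x : lower Y) : val (psi x X) <= val X by exact: (valP (psi x X)).
  apply/le_phi; rewrite // psiK /=.
  apply: le_trans (_ : Z `&` val X <= J); last exact: joins_sup (valP X).
  rewrite lexI psiX andbT.
  have := proj2 (le_phi X _ (psi z) (psiX z)) (lexx _).
  by rewrite psiK.
Qed.

Lemma iso_of_splits {d : Order.disp_t} {L : finTBLatticeType d}
    (D : {set L}) (Y : L) :
  splits D Y -> lower_prod_iso D Y.
Proof.
case/splitsP=> DY disj cover.
have joinY (f : lower_prod D) : \join_X val (f X) <= Y.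
  by apply/joinsP => X _; apply: le_trans (DY _ (valP X)); exact: (valP (f X)).
have meetj (f : lower_prod D) (X : {X : L | X \in D}) :
    val X `&` \join_W val (f W) = val (f X).
  have fX : val (f X) <= val X by exact: (valP (f X)).
  apply/le_anti/andP; split; last first.
    by rewrite lexI fX; apply: (joins_min (j := X)).
  apply: le_trans (disj _ _ (valP X) fX); apply: leI2 => //.
  apply/joinsP => W _; have [->|WX] := eqVneq W X; first exact: leUl.
  apply: le_trans (leUr _ _); apply: le_trans (_ : val W <= _).
    exact: (valP (f W)).
  by apply: (joins_min (j := val W)) => //; rewrite !inE val_eqE WX (valP W).
exists (fun f : lower_prod D =>
  exist _ (\join_X val (f X)) (joinY f) : lower Y); split => /=.
- (* The inverse of the join map takes meets with the factors. *)
  exists (fun z => [ffun X : {X : L | X \in D} =>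
      (exist _ (val z `&` val X) (leIr _ _) : lower (val X))]).
    move=> f; apply/ffunP => X; apply: val_inj; rewrite ffunE /= meetC.
    exact: meetj.
  case=> Z ZY; apply: val_inj => /=; apply/le_anti/andP; split.
    by apply/joinsP => X _; rewrite ffunE leIl.
  apply: le_trans (cover _ ZY) _; apply/joinsP => X XD.
  by apply: (joins_min (j := exist _ X XD)) => //; rewrite ffunE.
- move=> f g; split=> [le_fg X | le_fg].
    by rewrite -!meetj; apply: leI2.
  apply/joinsP => X _; apply: (joins_min (j := X)) => //.
  exact: le_fg.
- move=> X Z; apply/le_anti/andP; split.
    apply/joinsP => W _; rewrite ffunE.
    have [<-|neq] := eqVneq X W; first by rewrite dfwith_in.
    by rewrite dfwith_out // le0x.
  by apply: (joins_min (j := X)) => //; rewrite ffunE dfwith_in.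
Qed.

(** Besides removing the dependent products, this makes the existence of the
    isomorphism decidable, so that the building sets can be intersected as a
    finite family. *)
Lemma lower_prod_isoP {d : Order.disp_t} {L : finTBLatticeType d}
    {D : {set L}} {Y : L} :
  reflect (lower_prod_iso D Y) (splits D Y).
Proof. by apply: (iffP idP); [exact: iso_of_splits | exact: splits_of_iso]. Qed.

Definition is_building {d : Order.disp_t} {L : finTBLatticeType d}
    (B : {set L}) : bool :=
  (B \subset [set Y : L | \bot < Y]) &&
  [forall Y : L, (\bot < Y) ==> splits (maximals (below B Y)) Y].

Lemma building_setP {d : Order.disp_t} {L : finTBLatticeType d}
    {B : {set L}} :
  reflect (building_set B) (is_building B).
Proof.
apply: (iffP andP) => -[B0 hB]; split=> //.
  by move=> Y Y0; apply/lower_prod_isoP; move/forallP/(_ Y)/implyP: hB; apply.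
by apply/forallP => Y; apply/implyP => Y0; apply/lower_prod_isoP; apply: hB.
Qed.

(** * Maximal elements *)

(** The measure for inductions along the order of [L]. *)
Lemma card_lower_lt {d : Order.disp_t} {L : finTBLatticeType d} {X Y : L} :
  X < Y -> (#|[set Z : L | (Z <= X)%O]| < #|[set Z : L | (Z <= Y)%O]|)%N.
Proof.
move=> XY; apply: proper_card; apply/properP; split.
  by apply/subsetP => Z; rewrite !inE => ZX; apply: le_trans ZX (ltW XY).
by exists Y; rewrite !inE ?lexx // (lt_geF XY).
Qed.

Lemma le_maximals {d : Order.disp_t} {L : finTBLatticeType d}
    {B : {set L}} {Z : L} :
  Z \in B -> exists2 X, X \in maximals B & Z <= X.
Proof.
move=> ZB.
pose P X := (X \in B) && (Z <= X).
have PZ : P Z by rewrite /P ZB lexx.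
case: (arg_maxnP (fun X : L => #|[set V : L | (V <= X)%O]|) PZ).
move=> X /andP[XB ZX] maxX; rewrite /geq/= in maxX.
exists X => //; rewrite inE XB /=.
apply/forall_inP => W WB; apply/implyP => XW; rewrite eq_sym.
apply/negPn/negP => neq.
have /card_lower_lt : X < W by rewrite lt_neqAle neq.
by rewrite ltnNge (maxX W) // /P WB (le_trans ZX XW).
Qed.

Lemma maximals_belowP {d : Order.disp_t} {L : finTBLatticeType d}
    {B : {set L}} {X Y : L} :
  reflect [/\ X \in B, X <= Y
            & forall Z, Z \in B -> Z <= Y -> X <= Z -> Z = X]
          (X \in maximals (below B Y)).
Proof.
rewrite !inE -andbA; apply: (iffP and3P) => -[XB XY maxX]; split=> //.
  move=> Z ZB ZY XZ; move/forall_inP/(_ Z): maxX; rewrite inE ZB ZY.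
  by move=> /(_ isT)/implyP/(_ XZ)/eqP.
apply/forall_inP => Z; rewrite inE => /andP[ZB ZY].
by apply/implyP => XZ; apply/eqP/maxX.
Qed.

(** * Composing and restricting decompositions *)

Lemma splits_disjoint {d : Order.disp_t} {L : finTBLatticeType d}
    {D : {set L}} {Y X W : L} :
  splits D Y -> X \in D -> W \in D -> X != W -> X `&` W = \bot.
Proof.
case/splitsP=> _ disj _ XD WD neq; apply/eqP; rewrite -lex0.
apply: le_trans (disj X \bot XD (le0x _)).
rewrite join0x leI2 //; apply: (joins_min (j := W)) => //.
by rewrite !inE eq_sym neq.
Qed.

(** Since distinct factors meet in [\bot] and [B] avoids [\bot], an element
    of [B] lies below at most one factor. Hence the maximal elements of [B]
    below [Y] are those below the factors, taken together, and the claim is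
    that a product of products is a product. *)
Lemma splits_glue {d : Order.disp_t} {L : finTBLatticeType d}
    {B D : {set L}} {Y : L} :
  (forall Z, Z \in B -> \bot < Z) ->
  splits D Y ->
  (forall Z, Z \in B -> Z <= Y -> exists2 X, X \in D & Z <= X) ->
  (forall X, X \in D -> splits (maximals (below B X)) X) ->
  splits (maximals (below B Y)) Y.
Proof.
move=> B0 DY BD DB; case/splitsP: (DY) => D_le disj cover.
have max_loc E X : E \in maximals (below B Y) -> X \in D -> E <= X ->
    E \in maximals (below B X).
  case/maximals_belowP=> EB _ maxE XD EX; apply/maximals_belowP; split=> //.
  by move=> Z ZB ZX; apply: maxE => //; apply: le_trans ZX (D_le _ XD).
have max_glob E X : X \in D -> E \in maximals (below B X) ->
    E \in maximals (below B Y).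
  move=> XD /maximals_belowP[EB EX maxE]; apply/maximals_belowP; split=> //.
    exact: le_trans EX (D_le _ XD).
  move=> Z ZB ZY EZ; apply: maxE => //.
  have [W WD ZW] := BD Z ZB ZY.
  have [->//|XW] := eqVneq X W.
  have := B0 E EB; suff -> : E = \bot by rewrite ltxx.
  apply/eqP; rewrite -lex0 -(splits_disjoint DY XD WD XW) lexI EX.
  exact: le_trans EZ ZW.
apply/splitsP; split.
- by move=> E /maximals_belowP[].
- move=> E U EM UE; have [EB EY _] := maximals_belowP EM.
  have [X XD EX] := BD E EB EY.
  have /splitsP[_ disjX _] := DB X XD.
  have EMX := max_loc _ _ EM XD EX.
  (* Among the other maximal elements, [P] collects those in the factor [X]
     and [Q] bounds those in the other factors. The decomposition of [Y]
     removes [Q], then that of [X] removes [P]. *)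
  set P := \join_(W in maximals (below B X) :\ E) W.
  set Q := \join_(W in D :\ X) W.
  have UP_le : U `|` P <= X.
    rewrite leUx (le_trans UE EX) /=; apply/joinsP => W.
    by rewrite in_setD1 => /andP[_ /maximals_belowP[]].
  have join_le :
      U `|` \join_(W in maximals (below B Y) :\ E) W <= (U `|` P) `|` Q.
    rewrite -joinA leU2 //; apply/joinsP => W; rewrite in_setD1 => /andP[WE WM].
    have [WB WY _] := maximals_belowP WM.
    have [V VD WV] := BD W WB WY.
    have [VX|VX] := eqVneq V X.
      apply: le_trans (leUl _ _); apply: (joins_min (j := W)) => //.
      by rewrite in_setD1 WE max_loc // -VX.
    apply: le_trans (leUr _ _); apply: le_trans WV _.
    apply: (joins_min (j := V)) => //.
    by rewrite !inE VX.
  apply: le_trans (disjX E U EMX UE); rewrite lexI leIl /=.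
  apply: le_trans (disj X (U `|` P) XD UP_le).
  by apply: leI2.
- move=> Z ZY; apply: le_trans (cover Z ZY) _; apply/joinsP => X XD.
  have /splitsP[_ _ coverX] := DB X XD.
  apply: le_trans (coverX _ (leIr _ _)) _; apply/joinsP => E EM.
  apply: joins_min (max_glob _ _ XD EM) _.
  by apply: leI2 => //; exact: leIl.
Qed.

(** A product decomposition of [Y] cuts the interval below [W] into a product
    of intervals as well, since the coordinates of [W] bound those of the
    elements below it. *)
Lemma splits_restrict {d : Order.disp_t} {L : finTBLatticeType d}
    {D : {set L}} {W Y : L} :
  splits D Y -> W <= Y -> splits [set W `&` X | X in D] W.
Proof.
case/splitsP=> _ disj cover WY; apply/splitsP; split.
- by move=> _ /imsetP[X _ ->]; exact: leIl.
- move=> _ U /imsetP[X XD ->] UWX.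
  apply: le_trans (disj X U XD (le_trans UWX (leIr _ _))).
  apply: leI2; first exact: leIr.
  apply: leU2 => //; apply/joinsP => V; rewrite in_setD1 => /andP[VX].
  case/imsetP=> X' X'D defV; rewrite defV in VX *.
  apply: joins_min (leIr _ _); rewrite !inE X'D andbT.
  by apply: contraNneq VX => ->.
- move=> Z ZW; apply: le_trans (cover Z (le_trans ZW WY)) _.
  apply/joinsP => X XD; apply: joins_min (imset_f _ XD) _.
  by rewrite meetA (meet_l ZW).
Qed.

(** * Building sets *)

(** Elements of [B] need no test: there the maximal element is unique and the
    decomposition is trivial. At the others the given decomposition reduces
    the question to strictly smaller elements, where induction applies, and
    [splits_glue] assembles the answers. *)
Lemma building_set_by_splitting {d : Order.disp_t} {L : finTBLatticeType d}
    {B : {set L}} :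
  B \subset [set Y : L | \bot < Y] ->
  (forall W, \bot < W -> W \notin B ->
     exists D : {set L}, [/\ splits D W, forall X, X \in D -> X < W
       & forall Z, Z \in B -> Z <= W -> exists2 X, X \in D & Z <= X]) ->
  building_set B.
Proof.
move=> Bpos hB; have B0 Z : Z \in B -> \bot < Z.
  by move=> ZB; have := subsetP Bpos Z ZB; rewrite inE.
split=> // Y _; apply/lower_prod_isoP.
have [n] := ubnP #|[set Z : L | (Z <= Y)%O]|.
elim: n Y => // n IHn Y le_n.
have [->|Y0] := eqVneq Y \bot.
  (* The element [\bot] is the empty product. *)
  apply: (splits_glue (D := set0)) => //.
  - apply/splitsP; split=> [X||Z]; rewrite ?inE //.
      by move=> X U; rewrite inE.
    by rewrite lex0 => /eqP->; exact: le0x.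
  - by move=> Z /B0 Z0; rewrite (lt_geF Z0).
  - by move=> X; rewrite inE.
have [YB|YB] := boolP (Y \in B).
  have -> : maximals (below B Y) = [set Y].
    apply/setP => X; rewrite inE; apply/maximals_belowP/eqP => [[_ XY]|->].
      by move=> /(_ Y YB (lexx _) XY).
    by split=> // Z ZB ZY YZ; apply/le_anti/andP.
  apply/splitsP; split.
  - by move=> X /set1P->.
  - move=> X U /set1P-> _; rewrite setDv big_set0 joinx0; exact: leIr.
  - by move=> Z ZY; rewrite big_set1 (meet_l ZY).
have [|D [DY D_lt BD]] := hB Y _ YB; first by rewrite lt0x.
apply: splits_glue DY BD _ => // X XD; apply: IHn.
exact: leq_trans (card_lower_lt (D_lt X XD)) _.
Qed.

(** The converse of [building_set_by_splitting]: a building set is its own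
    source of the required decompositions. *)
Lemma building_set_maximals {d : Order.disp_t} {L : finTBLatticeType d}
    {B : {set L}} {W : L} :
  building_set B -> \bot < W -> W \notin B ->
  [/\ splits (maximals (below B W)) W,
      forall X, X \in maximals (below B W) -> X < W
    & forall Z, Z \in B -> Z <= W ->
        exists2 X, X \in maximals (below B W) & Z <= X].
Proof.
case=> _ hB W0 WB; split; first exact/lower_prod_isoP/hB.
- move=> X /maximals_belowP[XB XW _]; rewrite lt_neqAle XW andbT.
  by apply: contraNneq WB => <-.
- by move=> Z ZB ZW; apply: le_maximals; rewrite inE ZB.
Qed.

(** The first factor keeps [\bot] out when no building set contains [A], that
    is, when [A] contains [\bot]: the intersection of the empty family is all
    of [L]. *)
Definition building_closure {d : Order.disp_t} {L : finTBLatticeType d}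
    (A : {set L}) : {set L} :=
  [set Y : L | \bot < Y] :&: \bigcap_(B | is_building B && (A \subset B)) B.

Lemma building_closure_sub {d : Order.disp_t} {L : finTBLatticeType d}
    {A B : {set L}} :
  building_set B -> A \subset B -> building_closure A \subset B.
Proof.
move=> /building_setP hB AB; apply: subset_trans (subsetIr _ _) _.
by apply: bigcap_inf; rewrite hB AB.
Qed.

Lemma sub_building_closure {d : Order.disp_t} {L : finTBLatticeType d}
    {A : {set L}} :
  A \subset [set Y : L | \bot < Y] -> A \subset building_closure A.
Proof.
move=> hA; rewrite subsetI hA; apply/bigcapsP => B.
by case/andP.
Qed.

(** A single [B] of the family that misses [W] suffices: every element of the
    closure is in [B], hence lies below a factor of the decomposition of [W]
    that [B] gives. *)
Lemma building_set_closure {d : Order.disp_t} {L : finTBLatticeType d}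
    (A : {set L}) :
  building_set (building_closure A).
Proof.
apply: building_set_by_splitting => [|W W0]; first exact: subsetIl.
rewrite !inE W0 /= -in_setC setC_bigcap => /bigcupP[B].
case/andP=> /building_setP hB AB; rewrite inE => WB.
have [DW D_lt BD] := building_set_maximals hB W0 WB.
exists (maximals (below B W)); split=> // Z ZA.
exact/BD/(subsetP (building_closure_sub hB AB)).
Qed.

Lemma minimal_building_set_aboveE {d : Order.disp_t}
    {L : finTBLatticeType d} {A B : {set L}} :
  A \subset [set Y : L | \bot < Y] ->
  minimal_building_set_above A B <-> B = building_closure A.
Proof.
move=> hA; split=> [[hB AB minB]|->].
  by rewrite (minB _ (building_set_closure A) (sub_building_closure hA)) //
    building_closure_sub.
split; [exact: building_set_closure | exact: sub_building_closure |].
move=> C hC AC CA; apply/eqP; rewrite eqEsubset CA.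
exact: building_closure_sub.
Qed.

(** A deleted [W] below [Y] lies below no element of [M], so the meets
    [W `&` X] are strictly smaller than [W]; and an element that survives
    below [W] lies below some [X] in [M], hence below [W `&` X]. For a [W]
    already outside [B], the decomposition provided by [B] still works. *)
Lemma building_set_prune {d : Order.disp_t} {L : finTBLatticeType d}
    {B M : {set L}} {Y : L} :
  building_set B -> splits M Y ->
  building_set [set Z in B | (Z <= Y) ==> [exists X in M, Z <= X]].
Proof.
move=> hB MY; have [Bpos _] := hB.
apply: building_set_by_splitting => [|W W0].
  by apply/subsetP => Z; rewrite inE => /andP[ZB _]; apply: (subsetP Bpos).
have [WB|WB _] := boolP (W \in B); last first.
  have [DW D_lt BD] := building_set_maximals hB W0 WB.
  exists (maximals (below B W)); split=> // Z.
  by rewrite inE => /andP[ZB _]; apply: BD.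
rewrite inE WB negb_imply => /andP[WY /exists_inPn WM].
exists [set W `&` X | X in M]; split.
- exact: splits_restrict WY.
- move=> _ /imsetP[X XM ->]; rewrite lt_neqAle leIl andbT.
  by apply: contraNneq (WM X XM) => <-; exact: leIr.
- move=> Z; rewrite inE => /andP[_ /implyP ZM] ZW.
  have /exists_inP[X XM ZX] := ZM (le_trans ZW WY).
  by exists (W `&` X); [exact: imset_f | rewrite lexI ZW].
Qed.

Theorem proposition2p32 (d : Order.disp_t) (L : finTBLatticeType d)
    (A : {set L}) (hA : A \subset [set Y : L | \bot < Y]) :
  (exists! B : {set L}, minimal_building_set_above A B) /\
  (forall B : {set L}, minimal_building_set_above A B ->
     forall Y : L, Y \in B :\: A ->
       ~ lower_prod_iso (maximals (below A Y)) Y).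
Proof.
split.
  exists (building_closure A); split=> [|B].
    exact/minimal_building_set_aboveE.
  by move/(minimal_building_set_aboveE hA).
move=> B [hB AB minB] Y; rewrite inE => /andP[YA YB] /lower_prod_isoP MY.
(* Minimality applies to the pruned set, which cannot contain [Y]: an element
   of [A] that is at most [Y] and at least [Y] would be [Y] itself. *)
have hC := building_set_prune hB MY.
have := YB; rewrite -(minB _ hC).
- rewrite inE lexx YB => /exists_inP[X /maximals_belowP[XA XY _] YX].
  by case/negP: YA; rewrite (@le_anti _ _ Y X) // YX.
- apply/subsetP => Z ZA; rewrite inE (subsetP AB) //=; apply/implyP => ZY.
  have ZAY : Z \in below A Y by rewrite inE ZA.
  have [X XM ZX] := le_maximals ZAY.
  by apply/exists_inP; exists X.
- by apply/subsetP => Z; rewrite inE => /andP[].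
Qed.
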